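(* Let $B$ be a finite set with $k\ge2$ elements equipped with operators $t_1,\dots,t_s$, and assume that $B$ has a zero element $\theta$. Let $n\ge1$ and consider $k$-valued networks $X_i(t+1)=f_i(X_1(t),\dots,X_n(t))$, $i\in[1,n]$, with bearing space $B$. If $\mathcal{V}\subset\mathcal{X}=B^n$ is a universal invariant subspace, then $\mathcal{G}^*=\mathcal{V}^{\perp}$ is also universal, i.e. it is independent of the particular network dynamics: $\mathcal{V}^\perp$ is an invariant dual subspace of every such network with bearing space $B$.
   Context: Notation. $[1,n]=\{1,\dots,n\}$; $\delta_N^i$ is the $i$-th column of $I_N$; $\Delta_N=\{\delta_N^1,\dots,\delta_N^N\}$; $\mathcal{L}_{p\times q}$ is the set of $p\times q$ logical matrices (all columns in $\Delta_p$). Elements of $B$ are identified with $\delta_k^1,\dots,\delta_k^k$, and a state in $\mathcal{X}=B^n$ with $x=x_1\otimes\cdots\otimes x_n\in\Delta_{k^n}$; the algebraic form of a network is $x(t+1)=Mx(t)$ with $M\in\mathcal{L}_{k^n\times k^n}$ the unique logical matrix representing the one-step map. The dual space $\mathcal{X}^*$ is the set of all functions $B^n\to B$. Bearing space: a network has bearing space $B$ with operators $t_1,\dots,t_s$ (finitary operations on $B$) if its variables take values in $B$ and its update functions $f_i$ are compositions of these operators and the variables. Bearing subspace: a (nonempty) subset $H\subset B$ closed under every $t_i$. A universal invariant subspace is a set $\mathcal{V}=\mathcal{X}|_H=\{(X_1,\dots,X_n)\in B^n\mid X_i\in H\ \text{for all } i\}$ for some bearing subspace $H$ of $B$ (such a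 set is mapped into itself by every network with bearing space $B$). Zero element. $B$ has a zero element $\theta\in B$ if there is a binary operator $\odot$ over $B$ with $b\odot\theta=\theta\odot b=\theta$ for all $b\in B$. Perpendicular. $\mathcal{V}^{\perp}:=\{f\in\mathcal{X}^*\mid f(X)=\theta\ \text{for all } X\in\mathcal{V}\}$; as a dual subspace it is understood as the one generated by all its (finitely many) elements. Invariant dual subspace. For $g_1,\dots,g_r\in\mathcal{X}^*$, the dual subspace generated by them is the set of all functions (with values in $B$) of $g_1,\dots,g_r$; its structure matrix is $G\in\mathcal{L}_{k^r\times k^n}$ with $Gx=g_1(x)\otimes\cdots\otimes g_r(x)$ (vector forms). It is an invariant dual subspace of the network $x(t+1)=Mx(t)$ if there is $H'\in\mathcal{L}_{k^r\times k^r}$ with $GM=H'G$. *)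

(* Defs.v *)
From HB Require Import structures.
From mathcomp Require Import all_boot all_order all_algebra.
From mathcomp Require Import mxtens.

Set Implicit Arguments.
Unset Strict Implicit.
Unset Printing Implicit Defensive.

Import GRing.Theory.
Local Open Scope ring_scope.

(* [X = state B n] is B^n and [dual B n] is X^*, the functions B^n -> B. *)
Definition state (B : finType) (n : nat) := {ffun 'I_n -> B}.
Definition dual (B : finType) (n : nat) := {ffun state B n -> B}.

(* Operators on B: a family [t] indexed by 'I_s, the j-th one taking [ar j]
   arguments (nullary operators, i.e. constants, are allowed). *)
Definition operators (B : finType) (s : nat) (ar : 'I_s -> nat) :=
  forall j : 'I_s, {ffun 'I_(ar j) -> B} -> B.

Inductive composed (B : finType) (s : nat) (ar : 'I_s -> nat)
    (t : operators B ar) (n : nat) : dual B n -> Prop :=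
| composed_var (i : 'I_n) : composed t [ffun x : state B n => x i]
| composed_op (j : 'I_s) (g : 'I_(ar j) -> dual B n) :
    (forall a, composed t (g a)) ->
    composed t [ffun x : state B n => t j [ffun a => g a x]].

Definition has_bearing_space (B : finType) (s : nat) (ar : 'I_s -> nat)
    (t : operators B ar) (n : nat) (f : 'I_n -> dual B n) : Prop :=
  forall i, composed t (f i).

Definition bearing_subspace (B : finType) (s : nat) (ar : 'I_s -> nat)
    (t : operators B ar) (H : {set B}) : Prop :=
  H != set0 /\
  forall (j : 'I_s) (a : {ffun 'I_(ar j) -> B}),
    (forall i, a i \in H) -> t j a \in H.

Definition universal_invariant_subspace (B : finType) (s : nat)
    (ar : 'I_s -> nat) (t : operators B ar) (n : nat)
    (V : {set state B n}) : Prop :=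
  exists H : {set B},
    bearing_subspace t H /\ V = [set x : state B n | [forall i, x i \in H]].

Definition zero_element (B : finType) (theta : B) : Prop :=
  exists op : B -> B -> B, forall b, op b theta = theta /\ op theta b = theta.

Definition perp (B : finType) (theta : B) (n : nat) (V : {set state B n}) :
    {set dual B n} :=
  [set f : dual B n | [forall x in V, f x == theta]].

Fixpoint kron (k n : nat) : ('I_n -> 'cV[int]_k) -> 'cV[int]_(k ^ n) :=
  match n return ('I_n -> 'cV[int]_k) -> 'cV[int]_(k ^ n) with
  | 0 => fun _ => 1%:M
  | n'.+1 => fun v =>
      castmx (esym (expnS k n'), muln1 1)
        (tensmx (v ord0) (kron (fun i => v (lift ord0 i))))
  end.

(* b is identified with delta_k^i, k = #|B|, where i is its rank in the
   enumeration of B; [delta_mx i 0] is the i-th column of the identity. *)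
Definition vec1 (B : finType) (b : B) : 'cV[int]_#|B| :=
  delta_mx (enum_rank b) 0.

Definition vec (B : finType) (n : nat) (x : {ffun 'I_n -> B}) :
    'cV[int]_(#|B| ^ n) :=
  kron (fun i => vec1 (x i)).

Definition logical (p q : nat) (A : 'M[int]_(p, q)) : Prop :=
  forall j, exists i, col j A = delta_mx i 0.

(* The unique logical matrix A with A (vec x) = vec (phi x) for all x; see
   [structure_mxP]. *)
Definition structure_mx (B : finType) (n r : nat)
    (phi : state B n -> {ffun 'I_r -> B}) : 'M[int]_(#|B| ^ r, #|B| ^ n) :=
  \sum_(x : state B n) vec (phi x) *m (vec x)^T.

Definition network_mx (B : finType) (n : nat) (f : 'I_n -> dual B n) :
    'M[int]_(#|B| ^ n) :=
  structure_mx (fun x : state B n => [ffun i => f i x]).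

Definition dual_mx (B : finType) (n r : nat) (g : 'I_r -> dual B n) :
    'M[int]_(#|B| ^ r, #|B| ^ n) :=
  structure_mx (fun x : state B n => [ffun j => g j x]).

(* The dual subspace is given by its generators g_1, ..., g_r. *)
Definition invariant_dual_subspace (B : finType) (n r : nat)
    (g : 'I_r -> dual B n) (f : 'I_n -> dual B n) : Prop :=
  exists H' : 'M[int]_(#|B| ^ r),
    logical H' /\ dual_mx g *m network_mx f = H' *m dual_mx g.

Definition universal_dual_subspace (B : finType) (s : nat) (ar : 'I_s -> nat)
    (t : operators B ar) (n r : nat) (g : 'I_r -> dual B n) : Prop :=
  forall f : 'I_n -> dual B n,
    has_bearing_space t f -> invariant_dual_subspace g f.

(* All elements of W, as a generating family. *)
Definition elements (B : finType) (n : nat) (W : {set dual B n}) :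
    'I_#|W| -> dual B n :=
  fun j => enum_val j.
Arguments elements {B n} W _.

Fixpoint kron_index (k n : nat) : ('I_n -> 'I_k) -> 'I_(k ^ n) :=
  match n return ('I_n -> 'I_k) -> 'I_(k ^ n) with
  | 0 => fun _ => ord0
  | n'.+1 => fun u =>
      cast_ord (esym (expnS k n'))
        (mxtens_index (u ord0, kron_index (fun i => u (lift ord0 i))))
  end.

Lemma tensmx_delta (k m : nat) (i : 'I_k) (j : 'I_m) :
  tensmx (delta_mx i 0 : 'cV[int]_k) (delta_mx j 0 : 'cV[int]_m) =
  delta_mx (mxtens_index (i, j)) 0 :> 'cV[int]_(k * m).
Proof.
apply/matrixP=> a b; rewrite !mxE !ord1 !eqxx !andbT -natrM mulnb.
rewrite -(can_eq (@mxtens_unindexK k m)) mxtens_indexK.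
by case: (mxtens_unindex a).
Qed.

Lemma kron_delta (k n : nat) (u : 'I_n -> 'I_k) :
  kron (fun i => delta_mx (u i) 0) = delta_mx (kron_index u) 0.
Proof.
elim: n u => [|n IHn] u /=.
  by apply/matrixP=> i j; rewrite !ord1 !mxE.
rewrite IHn tensmx_delta; apply/matrixP=> i j.
by rewrite castmxE !mxE !ord1 !eqxx !andbT.
Qed.

Lemma kron_index_inj (k n : nat) (u v : 'I_n -> 'I_k) :
  kron_index u = kron_index v -> u =1 v.
Proof.
elim: n u v => [|n IHn] u v /= e i; first by case: i.
have {e}/(can_inj (@mxtens_indexK k (k ^ n))) [e0 /IHn e1] :=
  cast_ord_inj e.
by case: (unliftP ord0 i) => [j|] ->.
Qed.

Definition vec_index (B : finType) (n : nat) (x : {ffun 'I_n -> B}) :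
    'I_(#|B| ^ n) := kron_index (fun i => enum_rank (x i)).

Lemma vecE (B : finType) (n : nat) (x : {ffun 'I_n -> B}) :
  vec x = delta_mx (vec_index x) 0.
Proof. exact: kron_delta. Qed.

Lemma vec_index_bij (B : finType) (n : nat) : bijective (@vec_index B n).
Proof.
apply: inj_card_bij; last by rewrite card_ord card_ffun card_ord.
by move=> x y /kron_index_inj e; apply/ffunP=> i; apply/enum_rank_inj/e.
Qed.

Lemma structure_mx_vec (B : finType) (n r : nat)
    (phi : state B n -> {ffun 'I_r -> B}) (x : state B n) :
  structure_mx phi *m vec x = vec (phi x).
Proof.
rewrite /structure_mx mulmx_suml (bigD1 x) //= big1 ?addr0 => [|y ne_yx];
  rewrite -mulmxA !(vecE (n := n)) trmx_delta mul_delta_mx_cond.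
  rewrite eqxx mulr1n (_ : delta_mx _ _ = 1%:M) ?mulmx1 //.
  by apply/matrixP=> i j; rewrite !ord1 !mxE.
by rewrite (bij_eq (vec_index_bij B n)) (negPf ne_yx) mulmx0.
Qed.

Lemma structure_mxP (B : finType) (n r : nat)
    (phi : state B n -> {ffun 'I_r -> B}) (A : 'M[int]_(#|B| ^ r, #|B| ^ n)) :
  logical A /\ (forall x, A *m vec x = vec (phi x)) <-> A = structure_mx phi.
Proof.
have [h hK Kh] := vec_index_bij B n.
have colA (C : 'M[int]_(#|B| ^ r, #|B| ^ n)) j : col j C = C *m vec (h j).
  by rewrite vecE Kh colE.
split=> [[_ AE]|->].
  apply/matrixP=> i j; have := congr1 (fun c : 'cV_ _ => c i 0) (colA A j).
  by rewrite AE -structure_mx_vec -colA !mxE.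
split=> [j|x]; last exact: structure_mx_vec.
by exists (vec_index (phi (h j))); rewrite colA structure_mx_vec vecE.
Qed.

(* Main.v *)
Require Import Defs.
From mathcomp Require Import all_boot all_order all_algebra.

(** A composition of operators maps [H^n] into [H], so the one-step map [F] of
    any network maps [V] into [V], and [g \o F] vanishes on [V] whenever [g]
    does. Pulling back along [F] thus sends each generator of [V^perp] to
    another generator, and [H'] is the matrix of the corresponding selection of
    coordinates. *)

(** Turns [G M = H' G] into an equality of maps: with only [phi] expanded, [structure_mx psi] acts
    on each [vec (phi x)]. *)
Lemma structure_mx_comp (B : finType) (n r q : nat)
    (psi : state B r -> {ffun 'I_q -> B})
    (phi : state B n -> {ffun 'I_r -> B}) :
  (structure_mx psi *m structure_mx phi =
   structure_mx (fun x => psi (phi x)))%R.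
Proof.
rewrite [structure_mx phi]/structure_mx mulmx_sumr.
by apply: eq_bigr => x _; rewrite mulmxA structure_mx_vec.
Qed.

(** Induction on the composition: variables lie in [H] by assumption, operators preserve [H] by
    closure. *)
Lemma composed_bearing (B : finType) (s : nat) (ar : 'I_s -> nat)
    (t : operators B ar) (H : {set B}) (n : nat) (g : dual B n)
    (x : state B n) :
  bearing_subspace t H -> composed t g -> (forall i, x i \in H) -> g x \in H.
Proof.
move=> [_ Hcl] gP Hx; elim: gP => [i|j h _ IHh]; first by rewrite ffunE.
by rewrite ffunE; apply: Hcl => a; rewrite ffunE.
Qed.

Lemma pullback_invariant (B : finType) (n r : nat) (g : 'I_r -> dual B n)
    (f : 'I_n -> dual B n) (sigma : 'I_r -> 'I_r) :
  (forall j x, g (sigma j) x = g j [ffun i => f i x]) ->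
  invariant_dual_subspace g f.
Proof.
move=> gf.
(* If [y] lists the generators' values at a state, those at the next state are entries of [y],
   possibly repeated. *)
exists (structure_mx
  (fun y : state B r => [ffun j => y (sigma j)] : {ffun 'I_r -> B})).
split; first exact: proj1 (proj2 (structure_mxP _ _) erefl).
rewrite /dual_mx /network_mx !structure_mx_comp; apply: eq_bigr => x _.
by congr (vec _ *m _)%R; apply/ffunP => j; rewrite !ffunE gf.
Qed.

Lemma perp_pullback (B : finType) (theta : B) (n : nat) (V : {set state B n})
    (F : state B n -> state B n) (g : dual B n) :
  {in V, forall x, F x \in V} -> g \in perp theta V ->
  [ffun x => g (F x)] \in perp theta V.
Proof.
move=> FV; rewrite !inE => /forall_inP gV.
by apply/forall_inP => x Vx; rewrite ffunE gV ?FV.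
Qed.

Theorem proposition34 (B : finType) (hk : 1 < #|B|)
  (s : nat) (ar : 'I_s -> nat) (t : operators B ar)
  (theta : B) (htheta : zero_element theta)
  (n : nat) (hn : 0 < n) (V : {set state B n})
  (hV : universal_invariant_subspace t V) :
  universal_dual_subspace t (elements (perp theta V)).
Proof.
move=> f fP; have [H [HB VE]] := hV.
pose F (x : state B n) : state B n := [ffun i => f i x].
have FV : {in V, forall x, F x \in V}.
  move=> x; rewrite VE !inE => /forallP Hx.
  by apply/forallP => i; rewrite ffunE; apply: composed_bearing HB (fP i) Hx.
have pullW j := perp_pullback _ theta _ _ F _ FV (enum_valP j).
(* The hole is filled later by unification with the pullback of the [j]-th generator. It lies in
   [perp theta V], so [enum_rank_in] never returns its default. *)
apply: (pullback_invariant _ _ _ _ _ (fun j => enum_rank_in (pullW j) _)) => j x.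
rewrite /elements enum_rankK_in; last exact: pullW.
by rewrite ffunE.
Qed.
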